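(* For every $\varepsilon>0$ there exists $d_0=d_0(\varepsilon)\ge1$ such that for all $d\ge d_0$ and all $0<\beta\le(1-\varepsilon)\beta_c(d)$ the following holds. Consider $\mathbf G=\mathbf G(n,d/n)$ and the Edwards–Anderson model on $\mathbf G$ at inverse temperature $\beta$. For a fixed vertex $u$ of $\mathbf G$, $$\Pr\Big[\mathcal A(u)\ge \mathbb E[\mathcal A(u)]+\tfrac{\varepsilon}{2}\Big]\le \exp\Big(-\frac{\varepsilon^4}{8\pi}\,d\Big).$$
   Context: $\mathbf{G}(n,d/n)$: random graph on $n$ vertices, each edge present independently with probability $d/n$. The Edwards–Anderson model on $\mathbf G$ at inverse temperature $\beta>0$ is given by couplings $J_e$, $e\in E(\mathbf G)$, i.i.d. standard Gaussians; it defines for each edge $e$ the influence $\Gamma_e=\frac{|1-\exp(\beta J_e)|}{1+\exp(\beta J_e)}$ and for each vertex $u$ the aggregate influence $\mathcal A(u)=\sum_{w\sim u}\Gamma_{\{u,w\}}$ (sum over neighbours of $u$). The probability and expectation are over both $\mathbf G$ and the couplings. $\beta_c(k)=\sqrt{2\pi}/k$. *)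

(* Defs.v *)
From HB Require Import structures.
From mathcomp Require Import all_boot all_order all_algebra.
From mathcomp Require Import all_classical all_reals all_analysis.

Set Implicit Arguments.
Unset Strict Implicit.
Unset Printing Implicit Defensive.

Import Order.TTheory GRing.Theory Num.Theory.

Local Open Scope classical_set_scope.
Local Open Scope ring_scope.

Definition pairs (V : finType) : {set {set V}} := 
  [set e : {set V} | #|e| == 2%N]%SET.

Definition sgraph (V : finType) := {E : {set {set V}} | E \subset pairs V}.

Definition edges (V : finType) (g : sgraph V) : {set {set V}} := sval g.

(* For u = w the set [set u; w] is a singleton, hence never an edge. *)
Definition adj (V : finType) (g : sgraph V) : rel V :=
  fun u w => ([set u; w]%SET \in edges g).

Definition mutually_independent_events (d : measure_display)
    (T : measurableType d) (R : realType) (P : probability T R)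
    (I : finType) (A : {set I}) (E : I -> set T) : Prop :=
  (forall i, i \in A -> measurable (E i)) /\
  (forall B : {set I}, B \subset A ->
     P (\bigcap_(i in [set` B]) E i) = (\prod_(i in B) P (E i))%E).

Definition gnp_graph (d : measure_display) (T : measurableType d)
    (R : realType) (P : probability T R) (n : nat) (p : R)
    (G : T -> sgraph 'I_n) : Prop :=
  let present (e : {set 'I_n}) := [set w | e \in edges (G w)] in
  mutually_independent_events P (pairs 'I_n) present /\
  (forall e, e \in pairs 'I_n -> P (present e) = p%:E).

(* Conditionally on G = g, the couplings (J e), e an edge of g, are i.i.d.
   standard Gaussian.  The values of J e off the edges of the graph are
   irrelevant and left unconstrained. *)
Definition gaussian_couplings (d : measure_display) (T : measurableType d)
    (R : realType) (P : probability T R) (n : nat)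
    (G : T -> sgraph 'I_n) (J : {set 'I_n} -> {RV P >-> R}) : Prop :=
  forall (g : sgraph 'I_n) (B : {set 'I_n} -> set R),
    (forall e, e \in edges g -> measurable (B e)) ->
    P ((G @^-1` [set g]) `&` \bigcap_(e in [set` edges g]) (J e @^-1` B e)) =
    (P (G @^-1` [set g]) * \prod_(e in edges g) normal_prob 0 1 (B e))%E.

Definition influence (R : realType) (beta j : R) : R :=
  `|1 - expR (beta * j)| / (1 + expR (beta * j)).

Definition aggregate_influence (d : measure_display) (T : measurableType d)
    (R : realType) (P : probability T R) (n : nat) (beta : R)
    (G : T -> sgraph 'I_n) (J : {set 'I_n} -> {RV P >-> R})
    (u : 'I_n) : T -> R :=
  fun w => \sum_(v | adj (G w) u v) influence beta (J [set u; v]%SET w).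

Definition beta_c (R : realType) (k : R) : R := Num.sqrt (2 * pi) / k.

(* Main.v *)
(* Chernoff's method with parameter l = eps^3 d / (2 pi), where d0 = 1 already
   works.  Conditioning on the finitely many values of the graph, and expanding
   the product of 1 + (M - 1) 1_{e present} over the possible edges e at u, gives

     E[exp (l A(u))] = (1 + (M - 1) p) ^ k,   E[A(u)] = k p m,

   with p = d / n, k <= n the number of possible edges at u, N a standard
   Gaussian, Gamma = influence beta, m = E[Gamma(N)] and
   M = E[exp (l Gamma(N))].  The mean cancels the linear part of M - 1.  As
   Gamma(j) <= beta |j| and y |-> exp y - 1 - y scales at most quadratically
   under contractions, the remainder is at most
   (l beta)^2 E[exp |N|] <= 4 (l beta)^2, and the exponent is bounded by means
   of eps (1 - eps) <= 1/4. *)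

Require Import Defs.
From HB Require Import structures.
From mathcomp Require Import all_boot all_order all_algebra.
From mathcomp Require Import all_classical all_reals all_analysis.
From mathcomp Require Import measurable_realfun ring lra.

Set Implicit Arguments.
Unset Strict Implicit.
Unset Printing Implicit Defensive.

Import Order.TTheory GRing.Theory Num.Theory.
Import numFieldNormedType.Exports.

Local Open Scope classical_set_scope.
Local Open Scope ring_scope.

(** * Elementary bounds on the exponential and on the influence *)

(** Termwise comparison of power series: the remainder has only terms of degree [k >= 2], and there
    [s ^+ k <= s ^+ 2]. This turns the smallness of [l * beta] into a quadratic gain. *)
Lemma expR_remainder_scale (R : realType) (s x : R) :
  0 <= s <= 1 -> 0 <= x ->
  expR (s * x) - 1 - s * x <= s ^+ 2 * (expR x - 1 - x).
Proof.
move=> /andP[s0 s1] x0.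
have cvgS y : series (exp_coeff y) @ \oo --> expR y.
  exact: is_cvg_series_exp_coeff.
have cl : (series (exp_coeff (s * x)) n - 1 - s * x) @[n --> \oo] -->
    expR (s * x) - 1 - s * x.
  by do 2 (apply: cvgB; last exact: cvg_cst); exact: cvgS.
have cr : (s ^+ 2 * (series (exp_coeff x) n - 1 - x)) @[n --> \oo] -->
    s ^+ 2 * (expR x - 1 - x).
  apply: cvgM; first exact: cvg_cst.
  by do 2 (apply: cvgB; last exact: cvg_cst); exact: cvgS.
apply: (ler_cvg_to cl cr); near=> n.
(* With at least two terms in the partial sums, the constant and linear ones can be split off, and
   they cancel against [1] and [s * x]. *)
have [m ->] : exists m, n = m.+2.
  have n2 : (2 <= n)%N by near: n; exact: nbhs_infty_ge.
  by exists (n - 2)%N; rewrite -addn2 subnK.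
rewrite /series /= !big_nat_recl//= /exp_coeff/= !expr0 !expr1 !fact0 !factS.
rewrite fact0 !muln1 !divr1.
set a := \sum_(_ <= _ < _) _; set b := \sum_(_ <= _ < _) _.
suff : a <= s ^+ 2 * b by lra.
rewrite /a /b mulr_sumr; apply: ler_sum => i _; rewrite exprMn -mulrA.
apply: ler_wpM2r; first by rewrite divr_ge0// exprn_ge0.
by rewrite -addn2 exprD ler_piMl ?sqr_ge0// exprn_ile1.
Unshelve. all: by end_near. Qed.

Lemma influence_ge0 (R : realType) (beta j : R) : 0 <= influence beta j.
Proof. by rewrite /influence divr_ge0// addr_ge0// expR_ge0. Qed.

Lemma influence_le1 (R : realType) (beta j : R) : influence beta j <= 1.
Proof.
have e0 := expR_gt0 (beta * j).
rewrite /influence ler_pdivrMr ?mul1r; last by lra.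
by rewrite ler_norml; apply/andP; split; lra.
Qed.

(** With [x = beta * j] the influence is |tanh(x/2)|. The bound follows from [1 - x <= expR (- x)]
    when [x >= 0] and from [1 + x <= expR x] when [x < 0]. *)
Lemma influence_le_norm (R : realType) (beta j : R) :
  influence beta j <= `|beta * j|.
Proof.
rewrite /influence; set x := beta * j.
have e0 := expR_gt0 x; have := expR_ge1Dx x; have := expR_ge1Dx (- x).
rewrite expRN => h1 h2.
rewrite ler_pdivrMr; last by lra.
have h3 : (1 - x) * expR x <= 1 by rewrite -ler_pdivlMr// mul1r.
have [x0|x0] := leP 0 x.
  rewrite ler0_norm; last by lra.
  by rewrite ger0_norm//; nra.
rewrite ger0_norm ?ltr0_norm//; first by nra.
by rewrite subr_ge0 -expR0 ler_expR ltW.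
Qed.

Lemma measurable_influence (R : realType) (beta : R) :
  measurable_fun setT (influence beta).
Proof.
apply: measurable_funM.
  apply: measurableT_comp => //; apply: measurable_funB => //.
  by apply: measurableT_comp => //; exact: measurable_funM.
(* Inversion is continuous only off 0, so the composition goes through the open set of nonzero
   reals, which contains every value of the denominator. *)
apply: (@measurable_comp _ _ _ _ _ _ [set x : R | x != 0]).
- by apply: open_measurable; exact: open_neq.
- by move=> _ [x _ <-] /=; rewrite gt_eqF// addr_gt0// expR_gt0.
- apply: open_continuous_measurable_fun; first exact: open_neq.
  by move=> x; rewrite inE => x0; exact: inv_continuous.
- apply: measurable_funD => //.
  by apply: measurableT_comp => //; exact: measurable_funM.
Qed.

(** * Integration against the image of a measure with density *)

Section density_image.
Import HBNNSimple.

(* The hypothesis says that the image under [J] of the measure with density [H]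
   is [c] times [nu]. *)
Lemma ge0_integral_density_image d1 d2 (T : measurableType d1)
    (Y : measurableType d2) (R : realType) (mu : {measure set T -> \bar R})
    (nu : {measure set Y -> \bar R}) (H : T -> R) (J : T -> Y) (c : R)
    (f : Y -> \bar R) :
  measurable_fun setT H -> (forall x, 0 <= H x) ->
  measurable_fun setT J -> 0 <= c ->
  (forall B, measurable B ->
    \int[mu]_x (H x * \1_B (J x))%:E = c%:E * nu B)%E ->
  measurable_fun setT f -> (forall y, 0 <= f y)%E ->
  (\int[mu]_x ((H x)%:E * f (J x)) = c%:E * \int[nu]_y f y)%E.
Proof.
move=> mH H0 mJ c0 HB mf f0.
(* Simple functions increasing to [f]: the identity is proved for each [h n] by summing over its
   values, and monotone convergence on both sides carries it to [f]. *)
pose h := nnsfun_approx measurableT mf.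
have mhJ n : measurable_fun setT (fun x => h n (J x))
  by exact: measurableT_comp.
have simple n : (\int[mu]_x (H x * h n (J x))%:E =
    c%:E * \int[nu]_y (h n y)%:E)%E.
  transitivity (\sum_(r \in range (h n)) \int[mu]_x
      (r%:E * (H x * \1_(h n @^-1` [set r]) (J x))%:E))%E.
    rewrite -ge0_integral_fsum//.
    - apply: eq_integral => x _; rewrite fsumEFin// [in LHS]fimfunE.
      by rewrite mulr_fsumr; congr EFin; apply: eq_fsbigr => r _; rewrite mulrCA.
    - move=> r; apply: emeasurable_funM => //; apply/measurable_EFinP.
      apply: measurable_funM => //; apply: measurableT_comp => //.
    - move=> r x _ ; rewrite -EFinM mulrCA EFinM mule_ge0 ?lee_fin//.
      exact: nnfun_muleindic_ge0.
  transitivity (\sum_(r \in range (h n)) c%:E * (r%:E * nu (h n @^-1` [set r])))%E.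
    apply: eq_fsbigr => r; rewrite inE => -[y _ <-].
    rewrite ge0_integralZl//.
    - by rewrite HB// muleCA.
    - apply/measurable_EFinP.
      apply: measurable_funM => //; apply: measurableT_comp => //.
    - by move=> x _; rewrite lee_fin mulr_ge0// indicE.
    - by rewrite lee_fin.
  rewrite -ge0_mule_fsumr; last by move=> r; exact: nnsfun_mulemu_ge0.
  by rewrite integralT_nnsfun sintegralE.
have cvl : (\int[mu]_x (H x * h n (J x))%:E)%E @[n --> \oo] -->
    (\int[mu]_x ((H x)%:E * f (J x)))%E.
  rewrite [X in _ --> X](_ : _ =
      \int[mu]_x limn (fun n => (H x * h n (J x))%:E))%E; last first.
    apply: eq_integral => x _; apply/esym/cvg_lim => //.
    under eq_fun do rewrite EFinM.
    by apply: cvgeZl => //; exact: cvg_nnsfun_approx.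
  apply: cvg_monotone_convergence => //.
  - by move=> n; apply/measurable_EFinP; exact: measurable_funM.
  - by move=> n x _; rewrite lee_fin mulr_ge0.
  - move=> x _ m n mn; rewrite lee_fin ler_wpM2l//.
    exact/lefP/nd_nnsfun_approx.
have cvr : (c%:E * \int[nu]_y (h n y)%:E)%E @[n --> \oo] -->
    (c%:E * \int[nu]_y f y)%E.
  apply: cvgeZl => //.
  rewrite [X in _ --> X](_ : _ = \int[nu]_y limn (fun n => (h n y)%:E))%E.
    apply: cvg_monotone_convergence => //.
    - by move=> n; exact/measurable_EFinP.
    - by move=> n x _; rewrite lee_fin.
    - by move=> x _ m n mn; rewrite lee_fin; exact/lefP/nd_nnsfun_approx.
  by apply: eq_integral => x _; apply/esym/cvg_lim => //; exact: cvg_nnsfun_approx.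
apply: (cvg_unique _ cvl); first exact: ereal_hausdorff.
by move: cvr; under eq_fun do rewrite -simple.
Qed.

End density_image.

(** * Gaussian integrals *)

Lemma integral_normal_prob (R : realType) (m s : R) (f : R -> \bar R) :
  measurable_fun setT f -> (forall x, 0 <= f x)%E ->
  (\int[normal_prob m s]_x f x =
   \int[lebesgue_measure]_x ((normal_pdf m s x)%:E * f x))%E.
Proof.
move=> mf f0; rewrite -[LHS]mul1e; apply/esym.
apply: (@ge0_integral_density_image _ _ _ _ _ lebesgue_measure (normal_prob m s)
  (normal_pdf m s) id 1 f) => //.
- exact: measurable_normal_pdf.
- exact: normal_pdf_ge0.
- move=> B mB; rewrite mul1e /normal_prob [RHS]integral_mkcond.
  by apply: eq_integral => x _; rewrite epatch_indic EFinM.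
Qed.

(** Completing the square: [expR (t * x)] times the standard density is [expR (t ^+ 2 / 2)] times
    the density with mean [t], which has total mass 1. *)
Lemma integral_normal_prob_expR (R : realType) (t : R) :
  (\int[normal_prob 0 1]_x (expR (t * x))%:E = (expR (t ^+ 2 / 2))%:E)%E.
Proof.
have mexp : measurable_fun [set: R] (fun x => (expR (t * x))%:E).
  apply/measurable_EFinP; apply: measurableT_comp => //.
rewrite integral_normal_prob//.
transitivity (\int[lebesgue_measure]_x
    ((expR (t ^+ 2 / 2))%:E * (normal_pdf t 1 x)%:E))%E.
  apply: eq_integral => x _; rewrite -!EFinM !normal_pdfE ?oner_eq0//.
  rewrite mulrCA -mulrA /normal_fun -!expRD; congr (_ * expR _)%:E.
  by field.
rewrite ge0_integralZl//.
- by rewrite integral_normal_pdf mule1.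
- by apply/measurable_EFinP; exact: measurable_normal_pdf.
- by move=> x _; rewrite lee_fin normal_pdf_ge0.
Qed.

Lemma expR_half_le2 (R : realType) : expR (2^-1) <= 2 :> R.
Proof.
rewrite -[leLHS]invrK -expRN invf_ple ?posrE ?expR_gt0//.
have := expR_ge1Dx (- 2^-1 : R); lra.
Qed.

(** Since [expR |x| <= expR x + expR (- x)], the integral is at most twice [expR (1/2)], hence at
    most 4. *)
Lemma integral_normal_prob_expR_norm (R : realType) :
  (\int[normal_prob 0 1]_x (expR `|x : R|)%:E <= 4%:E)%E.
Proof.
have mexp (t : R) : measurable_fun setT (fun x => (expR (t * x))%:E).
  by apply/measurable_EFinP; apply: measurableT_comp.
apply: (@le_trans _ _ (\int[normal_prob 0 1]_x
    ((expR (1 * x))%:E + (expR (-1 * x))%:E))%E).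
  apply: ge0_le_integral => //.
  - by apply/measurable_EFinP; apply: measurableT_comp.
  - by apply: emeasurable_funD; exact: mexp.
  - move=> x _; rewrite -EFinD lee_fin mul1r mulN1r.
    have := expR_ge0 x; have := expR_ge0 (- x).
    have [x0|x0] := leP 0 x; first by rewrite ger0_norm//; lra.
    by rewrite ltr0_norm//; lra.
rewrite ge0_integralD//; [|exact: mexp|exact: mexp].
rewrite !integral_normal_prob_expR -EFinD lee_fin sqrrN expr1n mul1r.
by have := expR_half_le2 R; lra.
Qed.

(** The exponent is at most [y = l * beta * |j|]; the remainder at [y] dominates the one at the
    exponent, and [expR_remainder_scale] with [s = l * beta] bounds it. *)
Lemma expR_influence_le (R : realType) (l beta j : R) : 0 <= l -> 0 <= beta ->
  l * beta <= 1 ->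
  expR (l * influence beta j) <=
    1 + l * influence beta j + (l * beta) ^+ 2 * expR `|j|.
Proof.
move=> l0 b0 lb1; set g := influence beta j.
have g0 : 0 <= g by exact: influence_ge0.
have lb0 : 0 <= l * beta by rewrite mulr_ge0.
have gle : l * g <= l * beta * `|j|.
  rewrite -mulrA ler_wpM2l// (le_trans (influence_le_norm _ _))//.
  by rewrite normrM (ger0_norm b0).
have := @expR_remainder_scale R (l * beta) `|j|.
rewrite lb0 lb1 => /(_ isT (normr_ge0 _)).
set y := l * beta * `|j| in gle *.
(* The map t -> exp t - t is nondecreasing on the nonnegative reals, shown by factoring exp y as
   exp(l g) exp(y - l g). *)
have mono : expR (l * g) - l * g <= expR y - y.
  have e1 := expR_ge1Dx (y - l * g).
  have e2 : 1 <= expR (l * g) by rewrite -expR0 ler_expR mulr_ge0.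
  have -> : expR y = expR (l * g) * expR (y - l * g).
    by rewrite -expRD addrCA subrr addr0.
  nra.
have := normr_ge0 j; have := expR_ge0 `|j|; have := sqr_ge0 (l * beta).
nra.
Qed.

Lemma integral_expR_influence_le (R : realType) (l beta : R) :
  0 <= l -> 0 <= beta -> l * beta <= 1 ->
  (\int[normal_prob 0 1]_x (expR (l * influence beta x))%:E <=
   1 + l%:E * \int[normal_prob 0 1]_x (influence beta x)%:E
   + (4 * (l * beta) ^+ 2)%:E)%E.
Proof.
move=> l0 b0 lb1.
have mi := @measurable_influence R beta.
have mli : measurable_fun setT (fun x : R => (l * influence beta x)%:E).
  by apply/measurable_EFinP; exact: measurable_funM.
have me : measurable_fun setT (fun x : R => (expR `|x|)%:E).
  by apply/measurable_EFinP; apply: measurableT_comp.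
have i0 := @influence_ge0 R beta.
apply: (@le_trans _ _ (\int[normal_prob 0 1]_x (1 + (l * influence beta x)%:E +
    ((l * beta) ^+ 2)%:E * (expR `|x|)%:E))%E).
  apply: ge0_le_integral => //.
  - apply/measurable_EFinP; apply: measurableT_comp => //.
    exact: measurable_funM.
  - apply: emeasurable_funD; first exact: emeasurable_funD.
    exact: emeasurable_funM.
  - by move=> x _; rewrite -EFinM -!EFinD lee_fin; exact: expR_influence_le.
rewrite ge0_integralD//; last 4 first.
- by move=> x _; rewrite adde_ge0// lee_fin mulr_ge0.
- exact: emeasurable_funD.
- by move=> x _; rewrite mule_ge0// lee_fin ?sqr_ge0.
- exact: emeasurable_funM.
rewrite ge0_integralZl//; last by rewrite lee_fin sqr_ge0.
rewrite ge0_integralD//; last by move=> x _; rewrite lee_fin mulr_ge0.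
rewrite integral_cst// [X in (1 * X)%E](probability_setT (normal_prob 0 1)) mul1e.
apply: leeD; last first.
  have := sqr_ge0 (l * beta); move: ((l * beta) ^+ 2) => q q0.
  by rewrite (mulrC 4) EFinM lee_wpmul2l ?lee_fin// integral_normal_prob_expR_norm.
rewrite leeD2l//; under eq_integral do rewrite EFinM.
rewrite ge0_integralZl//; first exact/measurable_EFinP.
by move=> x _; rewrite lee_fin.
Qed.

(** * Factorisation of integrals of products *)

Lemma prod_indic (T : Type) (R : realType) (I : finType) (A : {set I})
    (E : I -> set T) (x : T) :
  \prod_(i in A) \1_(E i) x = \1_(\bigcap_(i in [set` A]) E i) x :> R.
Proof.
rewrite [RHS]indicE; have [xE|xE] := boolP (x \in _).
  rewrite big1// => i iA.
  by rewrite indicE mem_set//; move/set_mem : xE; exact.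
have [i iA xEi] : exists2 i, i \in A & ~ E i x.
  apply: contrapT => h; move/negP : xE; apply; apply/mem_set => i iA.
  by apply: contrapT => nE; apply: h; exists i.
by rewrite (bigD1 i)//= indicE memNset// mul0r.
Qed.

(** Extends a product formula from sets to functions, replacing indicators by general factors one
    index at a time. Here [D] is meant to be the event that the graph takes a given value, and [c]
    its probability. *)
Lemma measure_bigcap_integral_prod d1 d2 (T : measurableType d1)
    (Y : measurableType d2) (R : realType) (mu : {measure set T -> \bar R})
    (nu : probability Y R) (I : finType) (A : {set I}) (D : set T)
    (J : I -> T -> Y) (c : R) (f : I -> Y -> R) :
  measurable D -> (forall i, measurable_fun setT (J i)) -> 0 <= c ->
  (forall B : I -> set Y, (forall i, i \in A -> measurable (B i)) ->
    mu (D `&` \bigcap_(i in [set` A]) (J i @^-1` B i)) =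
    c%:E * \prod_(i in A) nu (B i))%E ->
  (forall i, nu.-integrable setT (EFin \o f i)) ->
  (forall i y, 0 <= f i y) ->
  (\int[mu]_(x in D) (\prod_(i in A) f i (J i x))%:E =
   (c * \prod_(i in A) \int[nu]_y f i y)%:E)%E.
Proof.
move=> mD mJ c0 Hprod intf f0.
have EFin_prod (r : I -> R) (Q : pred I) :
    (\prod_(i | Q i) (r i)%:E)%E = (\prod_(i | Q i) r i)%:E.
  by elim/big_rec2 : _ => // i x y _ ->; rewrite EFinM.
(* The list [s] holds the indices where [g] may be arbitrary; elsewhere in [A] it is an indicator.
   For [s = enum A] that condition is vacuous. *)
suff claim (s : seq I) (g : I -> Y -> R) :
    (forall i, nu.-integrable setT (EFin \o g i)) -> (forall i y, 0 <= g i y) ->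
    (forall i, i \in A -> i \notin s -> exists2 B, measurable B & g i = \1_B) ->
    (\int[mu]_x (\1_D x * \prod_(i in A) g i (J i x))%:E =
      (c * \prod_(i in A) \int[nu]_y g i y)%:E)%E.
  rewrite -(claim (enum A))//; last by move=> i iA; rewrite mem_enum iA.
  rewrite [LHS]integral_mkcond; apply: eq_integral => x _.
  by rewrite epatch_indic -EFinM mulrC.
elim: s g => [|i0 s ih] g intg g0 gB.
  have /choice[B HB] : forall i, exists B, i \in A -> measurable B /\ g i = \1_B.
    move=> i; have [iA|_] := boolP (i \in A); last by exists set0.
    by have [B mB gE] := gB i iA isT; exists B.
  transitivity (\int[mu]_x
      (\1_(D `&` \bigcap_(i in [set` A]) (J i @^-1` B i)) x)%:E)%E.
    apply: eq_integral => x _; congr EFin.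
    rewrite indicI /=; congr (_ * _).
    by rewrite -prod_indic; apply: eq_bigr => i /HB[_ ->].
  have mcap : measurable (\bigcap_(i in [set` A]) (J i @^-1` B i)).
    apply: fin_bigcap_measurable; first exact: finite_finset.
    move=> i iA; rewrite -[X in measurable X]setTI; apply: mJ => //.
    by have [] := HB i iA.
  rewrite integral_indic//; last exact: measurableI.
  rewrite setIT Hprod; last by move=> i /HB[].
  rewrite EFinM -EFin_prod; congr (_ * _)%E; apply: eq_bigr => i iA.
  have [mB ->] := HB _ iA.
  by rewrite /Rintegral integral_indic// setIT fineK// fin_num_measure.
have [i0A|i0A] := boolP (i0 \in A); last first.
  apply: ih => // i iA iNs; apply: gB => //; rewrite inE negb_or iNs andbT.
  by apply: contraNneq i0A => <-.
rewrite (bigD1 i0)//= mulrCA.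
have mg i : measurable_fun setT (g i).
  by apply/measurable_EFinP; exact: measurable_int (intg i).
set c' := c * \prod_(i in A | i != i0) \int[nu]_y g i y.
have RI0 (h : Y -> R) : (forall y, 0 <= h y) -> 0 <= \int[nu]_y h y.
  by move=> h0; apply: fine_ge0; apply: integral_ge0 => y _; rewrite lee_fin.
(* All factors except the one at [i0] serve as a density, so that [ge0_integral_density_image]
   applies to [J i0]. *)
pose H x := \1_D x * \prod_(i in A | i != i0) g i (J i x).
transitivity (\int[mu]_x ((H x)%:E * (EFin \o g i0) (J i0 x)))%E.
  apply: eq_integral => x _; rewrite (bigD1 i0)//= -EFinM /H; congr EFin.
  by ring.
have intE i : (\int[nu]_y g i y)%:E = (\int[nu]_y (g i y)%:E)%E.
  by rewrite fineK//; exact: (integrable_fin_num measurableT (intg i)).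
rewrite mulrC EFinM intE.
apply: (@ge0_integral_density_image _ _ _ _ _ mu nu H (J i0) c'
  (EFin \o g i0)) => //.
- apply: measurable_funM => //.
  rewrite [X in measurable_fun _ X](_ : _ = fun x =>
      \prod_(i <- [seq i <- enum A | i != i0]) g i (J i x)).
    by apply: measurable_prod => i _; exact: measurableT_comp.
  by apply/funext => x; rewrite big_filter big_enum_cond.
- by move=> x; rewrite mulr_ge0// prodr_ge0.
- by rewrite mulr_ge0// prodr_ge0// => i _; exact: RI0.
- move=> B mB.
  (* With an indicator at [i0], this index leaves the list of arbitrary ones, and the induction
     hypothesis identifies the image measure on [B]. *)
  pose g' i := if i == i0 then \1_B else g i : Y -> R.
  have g'E i : i != i0 -> g' i = g i by rewrite /g' => /negbTE ->.
  have g'0 : g' i0 = \1_B by rewrite /g' eqxx.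
  transitivity (\int[mu]_x (\1_D x * \prod_(i in A) g' i (J i x))%:E)%E.
    apply: eq_integral => x _; rewrite [in RHS](bigD1 i0)//= g'0 /H; congr EFin.
    rewrite -mulrA [X in _ * X]mulrC; congr (_ * (_ * _)).
    by apply: eq_bigr => i /andP[_ /g'E ->].
  rewrite ih.
  + rewrite (bigD1 i0)//= g'0 /c' mulrCA mulrC EFinM; congr (_%:E * _)%E.
      by congr (_ * _); apply: eq_bigr => i /andP[_ /g'E ->].
    by rewrite /Rintegral integral_indic// setIT fineK// fin_num_measure.
  + move=> i; rewrite /g'; case: eqP => // _.
    exact: integrable_indic.
  + by move=> i y; rewrite /g'; case: eqP => // _; rewrite indicE.
  + move=> i iA iNs; have [->|ii0] := eqVneq i i0; first by exists B.
    by rewrite g'E//; apply: gB => //; rewrite inE negb_or ii0.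
- exact/measurable_EFinP.
- by move=> y; rewrite lee_fin.
Qed.

(** The fibers of [G] partition the space, so at each point one summand survives. This is the
    conditioning on the value of the graph. *)
Lemma ge0_integral_fibers d (T : measurableType d) (R : realType)
    (mu : {measure set T -> \bar R}) (I : finType) (G : T -> I)
    (h : I -> T -> \bar R) :
  (forall i, measurable (G @^-1` [set i])) ->
  (forall i, measurable_fun setT (h i)) -> (forall i x, 0 <= h i x)%E ->
  (\int[mu]_x h (G x) x = \sum_i \int[mu]_(x in G @^-1` [set i]) h i x)%E.
Proof.
move=> mG mh h0.
under [RHS]eq_bigr do rewrite integral_mkcond.
rewrite -ge0_integral_sum//.
- apply: eq_integral => x _; rewrite (bigD1 (G x))//= patchE mem_set//.
  rewrite big1 ?adde0// => i iG; rewrite patchE memNset//=.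
  by move=> /esym/eqP; rewrite (negbTE iG).
- by move=> i; apply/(measurable_restrictT _ (mG i)); exact: measurable_funS (mh i).
- by move=> i x _; exact: erestrict_ge0.
Qed.

(** Setting [u] to 0 off [A] allows distributing over all of [I]: a subset not contained in [A] then
    contributes a zero product. *)
Lemma prod_1D (R : comNzRingType) (I : finType) (A : {set I}) (u : I -> R) :
  \prod_(i in A) (1 + u i) = \sum_(B : {set I} | B \subset A) \prod_(i in B) u i.
Proof.
transitivity (\prod_i ((if i \in A then u i else 0) + 1)).
  rewrite big_mkcond; apply: eq_bigr => i _.
  by case: ifP => _; rewrite ?add0r// addrC.
rewrite bigA_distr [RHS]big_mkcond; apply: eq_bigr => B _.
rewrite -big_mkcond/=; have [BA|] := boolP (B \subset A).
  by apply: eq_bigr => i iB; rewrite (fintype.subsetP BA).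
by move=> /subsetPn[i iB iA]; rewrite (bigD1 i)//= (negbTE iA) mul0r.
Qed.

(** Expand by [prod_1D], use independence on each intersection of events, and fold the sum back with
    the same identity. *)
Lemma integral_prod_indep_events d (T : measurableType d) (R : realType)
    (P : probability T R) (I : finType) (A : {set I}) (E : I -> set T) (a : R) :
  mutually_independent_events P A E -> 0 <= a ->
  (\int[P]_x (\prod_(i in A) (1 + a * \1_(E i) x))%:E =
   (\prod_(i in A) (1 + a * fine (P (E i))))%:E)%E.
Proof.
move=> [mE indE] a0.
(* Intersecting with [A] makes [cap B] measurable for every [B], as the integral of the sum
   requires. *)
pose cap (B : {set I}) := \bigcap_(i in [set` (B :&: A)%SET]) E i.
have capE (B : {set I}) : B \subset A -> cap B = \bigcap_(i in [set` B]) E i.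
  by move=> BA; rewrite /cap; move/finset.setIidPl : BA => ->.
have mcap (B : {set I}) : measurable (cap B).
  apply: fin_bigcap_measurable; first exact: finite_finset.
  by move=> i /=; rewrite finset.inE => /andP[_ iA]; exact: mE.
transitivity (\int[P]_x \sum_(B <- enum (powerset A))
    (a ^+ #|B| * \1_(cap B) x)%:E)%E.
  apply: eq_integral => x _; rewrite prod_1D sumEFin; congr EFin.
  rewrite big_enum/=; apply: eq_big => [B|B BA]; first by rewrite powersetE.
  by rewrite big_split/= prodr_const prod_indic capE.
rewrite ge0_integral_sum//; last 2 first.
- by move=> B; apply/measurable_EFinP/measurable_funM => //; exact: measurable_indic.
- by move=> B x _; rewrite lee_fin mulr_ge0// ?exprn_ge0// indicE.
rewrite prod_1D -sumEFin big_enum/=.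
apply: eq_big => [B|B]; first by rewrite powersetE.
rewrite powersetE => BA; under eq_integral do rewrite EFinM.
rewrite ge0_integralZl//; last 2 first.
- by apply/measurable_EFinP/measurable_indic/mcap.
- by rewrite lee_fin exprn_ge0.
rewrite integral_indic//.
rewrite setIT capE// [X in (_ * X)%E](indE B BA).
rewrite big_split/= prodr_const EFinM; congr (_ * _)%E.
elim/big_rec2 : _ => // i x y iB ->.
by rewrite EFinM fineK// fin_num_measure//; apply: mE; exact: (fintype.subsetP BA).
Qed.

(** * Integrability under the standard Gaussian *)

Lemma integrable_normal_bounded (R : realType) (f : R -> R) (K : R) :
  measurable_fun setT f -> (forall y, 0 <= f y <= K) ->
  (normal_prob 0 1).-integrable setT (EFin \o f).
Proof.
move=> mf fK; apply: measurable_bounded_integrable => //.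
  by rewrite -ge0_fin_numE// fin_num_measure.
exists K; split; first exact: num_real.
move=> x Kx y _; have /andP[f0 fyK] := fK y.
by rewrite /= ger0_norm// (le_trans fyK)// ltW.
Qed.

Lemma integrable_influence (R : realType) (beta : R) :
  (normal_prob 0 1).-integrable setT (EFin \o influence beta).
Proof.
apply: (@integrable_normal_bounded _ _ 1); first exact: measurable_influence.
by move=> y; rewrite influence_ge0 influence_le1.
Qed.

Lemma integrable_expR_influence (R : realType) (beta l : R) : 0 <= l ->
  (normal_prob 0 1).-integrable setT
    (EFin \o (fun y => expR (l * influence beta y))).
Proof.
move=> l0; apply: (@integrable_normal_bounded _ _ (expR l)).
  apply: measurableT_comp => //; apply: measurable_funM => //.
  exact: measurable_influence.
by move=> y; rewrite expR_ge0 ler_expR ler_piMr// influence_le1.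
Qed.

Lemma Rintegral_normal_cst (R : realType) (c : R) :
  \int[normal_prob 0 1]_y (fun _ : R => c) y = c.
Proof.
rewrite Rintegral_cst//.
by rewrite [X in fine X](probability_setT (normal_prob 0 1)) mulr1.
Qed.

(** * The possible edges at a vertex *)

(** Indexing by edges instead of neighbours matches the presence events and the couplings, both
    indexed by edges. The number of elements is the [k] of the overview. *)
Definition star (n : nat) (u : 'I_n) : {set {set 'I_n}} :=
  [set [set u; v]%SET | v in [set~ u]]%SET.

Lemma star_sub_pairs (n : nat) (u : 'I_n) : star u \subset pairs 'I_n.
Proof.
apply/fintype.subsetP => e /imsetP[v]; rewrite !finset.inE => vu ->.
by rewrite cards2 (eq_sym u) vu.
Qed.

Lemma card_star_le (n : nat) (u : 'I_n) : (#|star u| <= n)%N.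
Proof.
by rewrite (leq_trans (leq_imset_card _ _))// (leq_trans (max_card _))// card_ord.
Qed.

(** The map from [v] to the pair of [u] and [v] is injective off [u], and [u] is not adjacent to
    itself because a singleton is not an edge. *)
Lemma sum_adj (R : nmodType) (n : nat) (g : sgraph 'I_n) (u : 'I_n)
    (F : {set 'I_n} -> R) :
  \sum_(v | adj g u v) F [set u; v]%SET =
  \sum_(e in star u | e \in edges g) F e.
Proof.
rewrite /star big_imset_cond/=.
  apply: eq_bigl => v; rewrite !finset.inE /adj.
  case: eqVneq => // ->; rewrite finset.setUid; apply/negbTE/negP => ug.
  have /fintype.subsetP/(_ _ ug) := svalP g.
  by rewrite finset.inE cards1.
move=> v w; rewrite !finset.inE => vu wu /setP /(_ v).
by rewrite !finset.inE eqxx orbT (negbTE vu) => /esym/eqP.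
Qed.

(** * Mean and moment generating function of the aggregate influence *)

Section random_graph.
Context {disp : measure_display} {T : measurableType disp} {R : realType}
  {P : probability T R} {n : nat} {p : R} {G : T -> sgraph 'I_n}
  {J : {set 'I_n} -> {RV P >-> R}}.
Hypotheses (gnpG : gnp_graph P p G) (gaussJ : gaussian_couplings G J).

Lemma measurable_edge_present (e : {set 'I_n}) :
  measurable [set w | e \in edges (G w)].
Proof.
have [[mG _] _] := gnpG.
have [eP|eP] := boolP (e \in pairs 'I_n); first exact: mG.
rewrite (_ : [set _ | _] = set0)//; apply/seteqP; split => // w /= ew.
by have /fintype.subsetP/(_ _ ew) := svalP (G w); rewrite (negbTE eP).
Qed.

(** A graph is determined by which edges are present, so the fiber is a finite intersection of
    presence events and their complements. *)
Lemma measurable_graph_fiber (g : sgraph 'I_n) : measurable (G @^-1` [set g]).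
Proof.
pose E e := [set w | e \in edges (G w)].
rewrite (_ : _ @^-1` _ = \bigcap_(e in [set: {set 'I_n}])
    (if e \in edges g then E e else ~` E e)).
  apply: fin_bigcap_measurable; first exact: finite_finset.
  move=> e _; case: ifP => _; last apply: measurableC.
    exact: measurable_edge_present.
  exact: measurable_edge_present.
apply/seteqP; split => [w /= <- e _|w /= h]; first by case: ifPn => // /negP.
apply: val_inj; apply/setP => e.
change ((e \in edges (G w)) = (e \in edges g)); have := h e I.
by case: ifPn => [_ /= -> //|_ /= /negP/negbTE].
Qed.

(** Integrates out the couplings: on each fiber of [G] they are independent Gaussians, and the
    weight [k] is constant there. *)
Lemma integral_couplings (k : sgraph 'I_n -> R) (f : {set 'I_n} -> R -> R) :
  (forall g, 0 <= k g) ->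
  (forall e, (normal_prob 0 1).-integrable setT (EFin \o f e)) ->
  (forall e y, 0 <= f e y) ->
  (\int[P]_w (k (G w) * \prod_(e in edges (G w)) f e (J e w))%:E =
   \int[P]_w (k (G w) * \prod_(e in edges (G w))
       \int[normal_prob 0 1]_y f e y)%:E)%E.
Proof.
move=> k0 intf f0.
have RI0 e : 0 <= \int[normal_prob 0 1]_y f e y.
  by apply: fine_ge0; apply: integral_ge0 => y _; rewrite lee_fin.
have mf e : measurable_fun setT (f e).
  by apply/measurable_EFinP; exact: measurable_int (intf e).
have mprod (g : sgraph 'I_n) :
    measurable_fun setT (fun w => \prod_(e in edges g) f e (J e w)).
  under eq_fun do rewrite -big_enum.
  by apply: measurable_prod => e _; exact: measurableT_comp.
rewrite (@ge0_integral_fibers _ _ _ P _ G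
  (fun g w => (k g * \prod_(e in edges g) f e (J e w))%:E)).
- rewrite (@ge0_integral_fibers _ _ _ P _ G (fun g w => (k g *
      \prod_(e in edges g) \int[normal_prob 0 1]_y f e y)%:E)).
  + apply: eq_bigr => g _.
    have mg := measurable_graph_fiber g.
    under eq_integral do rewrite EFinM.
    rewrite ge0_integralZl//; last 3 first.
    * by apply/measurable_EFinP; exact: measurable_funTS.
    * by move=> w _; rewrite lee_fin prodr_ge0.
    * by rewrite lee_fin.
    rewrite (@measure_bigcap_integral_prod _ _ _ _ _ P (normal_prob 0 1) _
      (edges g) _ J (fine (P (G @^-1` [set g])))) //.
    * by rewrite integral_cst// EFinM fineK ?fin_num_measure// muleA muleAC.
    * by move=> e; exact: (@measurable_funPT _ _ _ _ (J e)).
    * by rewrite fine_ge0.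
    * by move=> B mB; rewrite fineK ?fin_num_measure//; exact: gaussJ.
  + exact: measurable_graph_fiber.
  + by [].
  + by move=> g w; rewrite lee_fin mulr_ge0// prodr_ge0.
- exact: measurable_graph_fiber.
- by move=> g; apply/measurable_EFinP; exact: measurable_funM.
- by move=> g w; rewrite lee_fin mulr_ge0// prodr_ge0.
Qed.

Lemma aggregate_influenceE (beta : R) (u : 'I_n) (w : T) :
  aggregate_influence beta G J u w =
  \sum_(e in star u) (e \in edges (G w))%:R * influence beta (J e w).
Proof.
rewrite /aggregate_influence.
rewrite (sum_adj (G w) u (fun e => influence beta (J e w))) big_mkcondr.
by apply: eq_bigr => e _; case: ifP; rewrite ?mul1r ?mul0r.
Qed.

Lemma indic_edge_present (e : {set 'I_n}) (w : T) :
  \1_[set w | e \in edges (G w)] w = (e \in edges (G w))%:R :> R.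
Proof.
rewrite indicE; congr (nat_of_bool _)%:R.
by apply/idP/idP => [/set_mem//|ew]; exact/mem_set.
Qed.

Lemma measurable_edge_influence (beta : R) (e : {set 'I_n}) :
  measurable_fun setT
    (fun w => (e \in edges (G w))%:R * influence beta (J e w)).
Proof.
apply: measurable_funM; last first.
  by apply: measurableT_comp => //; exact: measurable_influence.
rewrite (_ : (fun _ => _) = \1_[set w | e \in edges (G w)]).
  by apply: measurable_indic; exact: measurable_edge_present.
by apply/funext => w; rewrite indic_edge_present.
Qed.

Lemma measurable_aggregate_influence (beta : R) (u : 'I_n) :
  measurable_fun setT (aggregate_influence beta G J u).
Proof.
rewrite (_ : aggregate_influence _ _ _ _ = fun w => \sum_(e <- enum (star u))
    (e \in edges (G w))%:R * influence beta (J e w)).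
  by apply: measurable_sum => e; exact: measurable_edge_influence.
by apply/funext => w; rewrite aggregate_influenceE big_enum.
Qed.

Lemma expectation_aggregate_influence (beta : R) (u : 'I_n) :
  ('E_P[aggregate_influence beta G J u] =
   (#|star u|%:R * (p * \int[normal_prob 0 1]_y influence beta y))%:E)%E.
Proof.
set m := \int[_]_y _.
have intI := integrable_influence beta.
have edge e : e \in star u -> (\int[P]_w
    ((e \in edges (G w))%:R * influence beta (J e w))%:E = (p * m)%:E)%E.
  move=> eu.
  (* With factors 1 away from [e], a single edge becomes a product over all edges of the graph; its
     presence goes into the weight [k]. *)
  pose f e' := if e' == e then influence beta else (fun=> 1) : R -> R.
  have f1 (F : {set 'I_n} -> R) (g : sgraph 'I_n) :
      (forall e', e' != e -> F e' = 1) ->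
      (e \in edges g)%:R * \prod_(e' in edges g) F e' = (e \in edges g)%:R * F e.
    move=> F1; have [eg|_] := boolP (e \in edges g); last by rewrite !mul0r.
    by rewrite (bigD1 e)//= big1 ?mulr1// => e' /andP[_ /F1].
  transitivity (\int[P]_w ((e \in edges (G w))%:R *
      \prod_(e' in edges (G w)) f e' (J e' w))%:E)%E.
    apply: eq_integral => w _.
    rewrite f1; first by rewrite /f eqxx.
    by move=> e' /negbTE ee'; rewrite /f ee'.
  rewrite (integral_couplings (k := fun g => (e \in edges g)%:R))//.
  - transitivity (\int[P]_w (m%:E * (\1_[set w | e \in edges (G w)] w)%:E))%E.
      apply: eq_integral => w _; rewrite f1.
        by rewrite /f eqxx -EFinM mulrC indic_edge_present.
      by move=> e' /negbTE ee'; rewrite /f ee' Rintegral_normal_cst.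
    rewrite ge0_integralZl//.
    + rewrite integral_indic//; last exact: measurable_edge_present.
      rewrite setIT mulrC EFinM; congr (_ * _)%E.
      by have [_ pE] := gnpG; apply: pE; exact: (fintype.subsetP (star_sub_pairs u)).
    + by apply/measurable_EFinP/measurable_indic; exact: measurable_edge_present.
    + rewrite lee_fin; apply: fine_ge0; apply: integral_ge0 => y _.
      by rewrite lee_fin influence_ge0.
  - move=> e'; rewrite /f; case: ifP => // _.
    by apply: (@integrable_normal_bounded _ _ 1) => // y; rewrite ler01 lexx.
  - by move=> e' y; rewrite /f; case: ifP => // _; exact: influence_ge0.
rewrite unlock.
transitivity (\int[P]_w \sum_(e <- enum (star u))
    ((e \in edges (G w))%:R * influence beta (J e w))%:E)%E.
  by apply: eq_integral => w _; rewrite aggregate_influenceE -sumEFin big_enum.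
rewrite ge0_integral_sum//.
- rewrite big_enum/=; rewrite (eq_bigr (fun=> (p * m)%:E))//.
  by rewrite sumEFin sumr_const mulr_natl.
- by move=> e; apply/measurable_EFinP; exact: measurable_edge_influence.
- by move=> e w _; rewrite lee_fin mulr_ge0// influence_ge0.
Qed.

(** The exponential is a product over the present edges at [u]. Integrating out the couplings turns
    each factor into [1 + (M - 1) * \1_(E e)], and independence of the edges gives the power. *)
Lemma mmt_gen_aggregate_influence (l beta : R) (u : 'I_n) : 0 <= l ->
  ('M_P (aggregate_influence beta G J u) l =
   ((1 + (\int[normal_prob 0 1]_y expR (l * influence beta y) - 1) * p)
     ^+ #|star u|)%:E)%E.
Proof.
move=> l0; set M := \int[_]_y _.
have intE := integrable_expR_influence beta l0.
(* This makes the coefficient [M - 1] nonnegative, as [integral_prod_indep_events] demands. *)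
have M1 : 1 <= M.
  rewrite -(Rintegral_normal_cst 1).
  apply: le_Rintegral => //.
    by apply: (@integrable_normal_bounded _ _ 1) => // y; rewrite ler01 lexx.
  by move=> y _; rewrite -[leLHS]expR0 ler_expR mulr_ge0// influence_ge0.
pose f e := if e \in star u then (fun y => expR (l * influence beta y))
  else (fun=> 1) : R -> R.
rewrite /mmt_gen_fun unlock.
transitivity (\int[P]_w (1 * \prod_(e in edges (G w)) f e (J e w))%:E)%E.
  apply: eq_integral => w _; congr EFin; rewrite mul1r/= aggregate_influenceE.
  rewrite mulr_suml expR_sum big_mkcond [RHS]big_mkcond.
  apply: eq_bigr => e _; rewrite /f;
    case: (e \in star u); case: (e \in edges _) => //.
    by rewrite mul1r mulrC.
  by rewrite !mul0r expR0.
rewrite (integral_couplings (k := fun=> 1))//.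
- pose E e := [set w | e \in edges (G w)].
  transitivity (\int[P]_w (\prod_(e in star u) (1 + (M - 1) * \1_(E e) w))%:E)%E.
    apply: eq_integral => w _; congr EFin; rewrite mul1r.
    rewrite big_mkcond [RHS]big_mkcond; apply: eq_bigr => e _.
    rewrite indic_edge_present /f;
    case: (e \in star u); case: (e \in edges _) => //.
    + by rewrite mulr1 addrC subrK.
    + by rewrite mulr0 addr0.
    + by rewrite Rintegral_normal_cst.
  rewrite integral_prod_indep_events.
  + congr EFin; rewrite -prodr_const; apply: eq_bigr => e eu.
    have [_ pE] := gnpG.
    by rewrite [X in fine X](pE e)//; exact: (fintype.subsetP (star_sub_pairs u)).
  + have [[mE iE] _] := gnpG; split.
      by move=> e _; exact: measurable_edge_present.
    by move=> B Bu; apply: iE; apply: (fintype.subset_trans Bu); exact: star_sub_pairs.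
  + by rewrite subr_ge0.
- move=> e; rewrite /f; case: ifP => // _.
  by apply: (@integrable_normal_bounded _ _ 1) => // y; rewrite ler01 lexx.
- by move=> e y; rewrite /f; case: ifP => // _; exact: expR_ge0.
Qed.

End random_graph.

(** * The exponent and the tail bound *)

(** In [l * beta] the factor [d] cancels against [beta_c d], leaving at most
    [eps ^+ 3 * (1 - eps) / sqrt (2 * pi)]. The quadratic cost is then at most
    [eps ^+ 4 / (8 * pi) * d], half of the gain [l * (eps / 2)]. *)
Lemma chernoff_exponent_le (R : realType) (eps d beta : R) :
  0 < eps < 1 -> 0 < d -> 0 < beta -> beta <= (1 - eps) * beta_c d ->
  let l := eps ^+ 3 / (2 * pi) * d in
  l * beta <= 1 /\
  4 * (l * beta) ^+ 2 * d - l * (eps / 2) <= - (eps ^+ 4 / (8 * pi) * d).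
Proof.
move=> /andP[e0 e1] d0 b0 /=; rewrite /beta_c.
(* Only [pi >= 2] matters from here on, so [pi] becomes a variable [t]. *)
have := pi_ge2 R; move: (pi : R) => t t2 bc.
have t0 : 0 < t by lra.
pose l := eps ^+ 3 / (2 * t) * d; rewrite -/l.
set q := Num.sqrt (2 * t) in bc *.
have q2 : q ^+ 2 = 2 * t by rewrite sqr_sqrtr// mulr_ge0// ltW.
have q0 : 0 < q by rewrite sqrtr_gt0 mulr_gt0.
have l0 : 0 < l by rewrite mulr_gt0// divr_gt0// ?exprn_gt0// mulr_gt0.
have e31 : eps ^+ 3 * (1 - eps) <= 1.
  by rewrite mulr_ile1 ?exprn_ile1 ?exprn_ge0 ?subr_ge0 ?ltW//; lra.
have lb : l * beta <= eps ^+ 3 * (1 - eps) / q.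
  apply: (@le_trans _ _ (l * ((1 - eps) * (q / d)))); first by rewrite ler_pM2l.
  rewrite /l -q2 le_eqVlt; apply/orP; left; apply/eqP.
  by field; rewrite ?gt_eqF//= gt_eqF.
have sq : (l * beta) ^+ 2 <= eps ^+ 4 * (1 / 16) / (2 * t).
  apply: (@le_trans _ _ ((eps ^+ 3 * (1 - eps) / q) ^+ 2)).
    rewrite lerXn2r// nnegrE; first by rewrite mulr_ge0// ltW.
    by rewrite divr_ge0 ?(ltW q0)// mulr_ge0 ?exprn_ge0 ?subr_ge0 ?ltW.
  rewrite expr_div_n q2 ler_pM2r ?invr_gt0 ?mulr_gt0//.
  rewrite (_ : (eps ^+ 3 * (1 - eps)) ^+ 2 = eps ^+ 4 * (eps * (1 - eps)) ^+ 2);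
    last by ring.
  rewrite ler_pM2l ?exprn_gt0//.
  have e14 : eps * (1 - eps) <= 1 / 4 by have := sqr_ge0 (eps - 1 / 2); nra.
  have e140 : 0 <= eps * (1 - eps) by rewrite mulr_ge0 ?subr_ge0 ?ltW.
  nra.
split.
  apply: (le_trans lb); rewrite ler_pdivrMr// mul1r (le_trans e31)//.
  rewrite -(@ler_pXn2r _ 2)//; [|by rewrite nnegrE|by rewrite nnegrE ltW].
  rewrite q2 expr1n.
  lra.
have -> : l * (eps / 2) = eps ^+ 4 / (4 * t) * d.
  by rewrite /l; field; rewrite gt_eqF.
have -> : eps ^+ 4 / (4 * t) * d = (2 * (eps ^+ 4 / (8 * t))) * d.
  by field; rewrite gt_eqF.
rewrite -[leRHS]mulNr -mulrBl ler_pM2r//.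
have -> : eps ^+ 4 / (8 * t) = 4 * (eps ^+ 4 * (1 / 16) / (2 * t)).
  by field; rewrite gt_eqF.
lra.
Qed.

Theorem theorem3p1 (R : realType) (eps : R) (eps_gt0 : 0 < eps) :
  exists d0 : R, 1 <= d0 /\
  forall d : R, d0 <= d ->
  forall beta : R, 0 < beta -> beta <= (1 - eps) * beta_c d ->
  forall n : nat, d <= n%:R ->
  forall (disp : measure_display) (T : measurableType disp)
         (P : probability T R)
         (G : T -> sgraph 'I_n) (J : {set 'I_n} -> {RV P >-> R}),
  gnp_graph P (d / n%:R) G ->
  gaussian_couplings G J ->
  forall u : 'I_n,
  (P [set w | 'E_P[aggregate_influence beta G J u] + (eps / 2)%:E
              <= (aggregate_influence beta G J u w)%:E]
   <= (expR (- (eps ^+ 4 / (8 * pi) * d)))%:E)%E.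
Proof.
exists 1; split=> // d d1 beta b0 bc n dn disp T P G J gnpG gaussJ u.
have d0 : 0 < d by lra.
have n0 : 0 < n%:R :> R by lra.
(* Forced by [0 < beta <= (1 - eps) * beta_c d]. *)
have e1 : eps < 1.
  have bc0 : 0 < beta_c d by rewrite divr_gt0// sqrtr_gt0 mulr_gt0// pi_gt0.
  by have := lt_le_trans b0 bc; rewrite pmulr_lgt0//; lra.
have e01 : 0 < eps < 1 by rewrite eps_gt0.
have [] := chernoff_exponent_le e01 d0 b0 bc.
set l := _ / _ * d => lb1 exponent.
have l0 : 0 < l.
  by rewrite mulr_gt0// divr_gt0// ?exprn_gt0// mulr_gt0// pi_gt0.
set p := d / n%:R in gnpG.
have p0 : 0 <= p by rewrite divr_ge0// ltW.
pose m : R := \int[normal_prob 0 1]_y influence beta y.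
pose M : R := \int[normal_prob 0 1]_y expR (l * influence beta y).
have Mle : M <= 1 + l * m + 4 * (l * beta) ^+ 2.
  have ME : M%:E = (\int[normal_prob 0 1]_y (expR (l * influence beta y))%:E)%E.
    rewrite fineK//.
    exact: (integrable_fin_num measurableT
      (integrable_expR_influence beta (ltW l0))).
  have mE : m%:E = (\int[normal_prob 0 1]_y (influence beta y)%:E)%E.
    rewrite fineK//.
    exact: (integrable_fin_num measurableT (integrable_influence beta)).
  have := integral_expR_influence_le (ltW l0) (ltW b0) lb1.
  by rewrite -ME -mE -EFinM -!EFinD lee_fin.
have kp : #|star u|%:R * p <= d.
  rewrite /p mulrA ler_pdivrMr// mulrC ler_pM2l// ler_nat.
  exact: card_star_le.
have mA := measurable_aggregate_influence gnpG (J := J) beta u.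
pose A : {RV P >-> R} := HB.pack (aggregate_influence beta G J u)
  (isMeasurableFun.Build _ _ _ _ _ mA).
rewrite (expectation_aggregate_influence gnpG gaussJ beta u) -/m.
apply: (le_trans (@chernoff _ _ _ P A l (#|star u|%:R * (p * m) + eps / 2) l0)).
rewrite (mmt_gen_aggregate_influence gnpG gaussJ beta u (ltW l0)) -/M.
(* A nonnegative base is needed to raise [1 + x <= expR x] to a power; it holds as [M >= 0] and
   [p <= 1], the latter from [d <= n]. *)
have base0 : 0 <= 1 + (M - 1) * p.
  have p1 : p <= 1 by rewrite ler_pdivrMr// mul1r.
  have M0 : 0 <= M.
    by apply: fine_ge0; apply: integral_ge0 => y _; rewrite lee_fin expR_ge0.
  by nra.
rewrite -EFinM lee_fin.
apply: (@le_trans _ _ (expR (#|star u|%:R * ((M - 1) * p)) *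
    expR (- (l * (#|star u|%:R * (p * m) + eps / 2))))).
  rewrite ler_pM2r ?expR_gt0// expRM_natl lerXn2r ?nnegrE ?expR_ge0//.
  exact: expR_ge1Dx.
rewrite -expRD ler_expR (le_trans _ exponent)//.
(* The mean contributes [l * m * K], which cancels the linear part of [(M - 1) * K]; the rest is at
   most [4 * (l * beta) ^+ 2 * K], and [K <= d]. *)
set K := #|star u|%:R * p in kp.
have K0 : 0 <= K by rewrite mulr_ge0.
have : (M - 1 - l * m) * K <= 4 * (l * beta) ^+ 2 * K by rewrite ler_wpM2r//; lra.
have : 4 * (l * beta) ^+ 2 * K <= 4 * (l * beta) ^+ 2 * d.
  by rewrite ler_wpM2l// mulr_ge0// sqr_ge0.
rewrite mulrDr opprD.
rewrite (_ : #|star u|%:R * ((M - 1) * p) = (M - 1) * K); last by rewrite /K; ring.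
rewrite (_ : #|star u|%:R * (p * m) = K * m); last by rewrite /K; ring.
lra.
Qed.
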